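(* Let $\lambda_0,\lambda_1,\lambda_2>0$, let $N_0,N_1,N_2$ be mutually independent homogeneous Poisson processes with parameters $\lambda_0,\lambda_1,\lambda_2$ respectively, started at $0$, and put $M_1(t)=N_1(t)+N_0(t)$, $M_2(t)=N_2(t)+N_0(t)$ for $t\ge0$. Then for $(r,s)=(1,2)$ or $(r,s)=(2,1)$, every $t>0$ and every $m=0,1,2,\dots$, $$\mathbb{E}\left(M_s(t)\mid M_r(t)=m\right)=\frac{m\lambda_0}{\lambda_r+\lambda_0}+\lambda_s t.$$
   Context: A homogeneous Poisson process with parameter $\lambda>0$ started at $0$ is a process with $N(0)=0$, independent stationary increments, and $N(t)$ Poisson distributed with mean $\lambda t$. *)

(* Defs.v *)
From HB Require Import structures.
From mathcomp Require Import all_boot all_order all_algebra.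
From mathcomp Require Import all_classical all_reals all_analysis.

Set Implicit Arguments.
Unset Strict Implicit.
Unset Printing Implicit Defensive.

Import Order.TTheory GRing.Theory Num.Theory.
Import numFieldNormedType.Exports.

Local Open Scope classical_set_scope.
Local Open Scope ring_scope.

(* Families [F i] of events are meant to be sigma-algebras. *)
Definition mutually_independent d (T : measurableType d) (R : realType)
    (P : probability T R) (I : finType) (F : I -> set (set T)) : Prop :=
  forall (J : {set I}) (E : I -> set T),
    (forall i, i \in J -> F i (E i)) ->
    P (\bigcap_(i in [set` J]) E i) = (\prod_(i in J) P (E i))%E.

Definition sigma_rv d d' (T : measurableType d) (U : measurableType d')
    (X : T -> U) : set (set T) :=
  preimage_set_system setT X measurable.

Definition sigma_process d d' (T : measurableType d) (U : measurableType d')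
    (R : realType) (X : R -> T -> U) : set (set T) :=
  <<s \bigcup_(t in [set t | 0 <= t]) sigma_rv (X t) >>.

(* Increments are real-valued because subtraction on [nat] is truncated. *)
Definition increment (T : Type) (R : realType) (N : R -> T -> nat) (s t : R) :
    T -> R :=
  fun x => (N t x)%:R - (N s x)%:R.

(* Processes are indexed by [R], but only times [t >= 0] are constrained.
   The Poisson law is required only for [0 < t]: the law at time 0 is given by
   [poisson_process_start], and [poisson_pmf 0] is not a probability mass
   function in the library. *)
Record poisson_process d (T : measurableType d) (R : realType)
    (P : probability T R) (lambda : R) (N : R -> {RV P >-> nat}) : Prop := {
  poisson_process_start : forall x, N 0 x = 0%N ;
  poisson_process_independent_increments :
    forall (n : nat) (t : nat -> R), 0 <= t 0%N -> nondecreasing_seq t ->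
      mutually_independent P
        (fun i : 'I_n => sigma_rv (increment N (t i) (t i.+1))) ;
  poisson_process_stationary_increments :
    forall s s' h : R, 0 <= s -> 0 <= s' -> 0 <= h ->
      forall B : set R, measurable B ->
        P (increment N s (s + h) @^-1` B) = P (increment N s' (s' + h) @^-1` B) ;
  poisson_process_law :
    forall t : R, 0 < t -> forall k : nat,
      P [set x | N t x = k] = (poisson_pmf (lambda * t) k)%:E
}.

(* E(X | A) = E(X 1_A) / P(A), for an event A of positive probability. *)
Definition cond_expectation d (T : measurableType d) (R : realType)
    (P : probability T R) (X : T -> R) (A : set T) : \bar R :=
  ('E_P[X \* \1_A] / P A)%E.

(* Main.v *)
Require Import Defs.
From HB Require Import structures.
From mathcomp Require Import all_boot all_order all_algebra.
From mathcomp Require Import all_classical all_reals all_analysis.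
From mathcomp Require Import measurable_realfun ring.

Set Implicit Arguments.
Unset Strict Implicit.
Unset Printing Implicit Defensive.

Import Order.TTheory GRing.Theory Num.Theory.
Import numFieldNormedType.Exports.

Local Open Scope classical_set_scope.
Local Open Scope ring_scope.

(** Only the values [X = N_0(t)], [Y = N_r(t)] and [Z = N_s(t)] at the fixed
    time [t] matter: they are independent Poisson variables with means
    [a = lambda_0 t], [b = lambda_r t] and [c = lambda_s t]
    ([poisson_joint_pmf]), and the claim concerns [E(Z + X | Y + X = m)].
    Since [Z] is independent of [(X, Y)], it contributes its mean [c]; given
    [Y + X = m], the variable [X] is binomial with parameters [m] and
    [a / (a + b)], which contributes [m a / (a + b)].

    Concretely ([cond_expectation_shared_component]), the conditioning event is
    the disjoint union over [i <= m] of the cells [{X = i, Y = m - i}], whose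
    probabilities are [p_i = pmf_a(i) pmf_b(m - i)]. On such a cell the
    integral of [Z + X] is [p_i (c + i)], so that only [sum_i p_i] and
    [sum_i i p_i] remain to be computed. The former is the Poisson weight of
    mean [a + b] at [m], by the binomial theorem
    ([poisson_pmf_convolution]). The latter is [m a / (a + b)] times the former
    ([poisson_pmf_convolution_mean]), by the size-biasing identity
    [k pmf_a(k) = a pmf_a(k - 1)]; the same identity gives the mean of the
    Poisson law. The time [t] cancels in [a / (a + b)]. *)

(** * Poisson weights *)

Lemma poisson_pmf_gt0 (R : realType) (a : R) (k : nat) :
  0 < a -> 0 < poisson_pmf a k.
Proof.
move=> a0; rewrite /poisson_pmf a0.
by rewrite !mulr_gt0 ?exprn_gt0 ?invr_gt0 ?ltr0n ?fact_gt0 ?expR_gt0.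
Qed.

(** Size-biasing identity: weighting a Poisson law by its value amounts, up
    to the factor [a], to shifting it by one. Both mean computations below rest on it. *)
Lemma poisson_pmfS (R : realType) (a : R) (k : nat) :
  0 < a -> k.+1%:R * poisson_pmf a k.+1 = a * poisson_pmf a k.
Proof.
move=> a0; rewrite /poisson_pmf a0 factS natrM exprS.
have k0 : (k`!%:R : R) != 0 by rewrite pnatr_eq0 -lt0n fact_gt0.
have k1 : (k.+1%:R : R) != 0 by rewrite pnatr_eq0.
move: k0 k1; move: (k`!%:R : R) (k.+1%:R : R) => u v u0 v0.
by field; rewrite u0 v0.
Qed.

Lemma poisson_pmf_convolution (R : realType) (a b : R) (m : nat) :
  0 < a -> 0 < b ->
  \sum_(i < m.+1) poisson_pmf a i * poisson_pmf b (m - i) =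
  poisson_pmf (a + b) m.
Proof.
move=> a0 b0; rewrite [RHS]/poisson_pmf addr_gt0// [a + b]addrC exprDn.
rewrite opprD expRD !mulr_suml; apply: eq_bigr => -[i/= im] _.
rewrite /poisson_pmf a0 b0 -mulr_natr -(bin_fact (im : (i <= m)%N)) !natrM.
have f0 n : (n`!%:R : R) != 0 by rewrite pnatr_eq0 -lt0n fact_gt0.
have c0 : ('C(m, i)%:R : R) != 0 by rewrite pnatr_eq0 -lt0n bin_gt0.
by field; rewrite !f0 c0.
Qed.

(** Size-biasing turns the sum into [a] times the convolution at [m - 1], and,
    used backwards for the mean [a + b], returns to the convolution at [m]. *)
Lemma poisson_pmf_convolution_mean (R : realType) (a b : R) (m : nat) :
  0 < a -> 0 < b ->
  \sum_(i < m.+1) i%:R * (poisson_pmf a i * poisson_pmf b (m - i)) =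
  m%:R * a / (a + b) * poisson_pmf (a + b) m.
Proof.
move=> a0 b0; case: m => [|m]; first by rewrite big_ord1 !mul0r.
rewrite big_ord_recl mul0r add0r.
under eq_bigr do rewrite lift0 subSS mulrA (poisson_pmfS _ a0) -mulrA.
rewrite -mulr_sumr poisson_pmf_convolution//.
have ab0 : 0 < a + b by rewrite addr_gt0.
have /(congr1 (fun y => a / (a + b) * y)) := poisson_pmfS m ab0.
have ab1 : a + b != 0 by rewrite gt_eqF.
rewrite [in RHS]mulrA divfK// => <-.
by rewrite mulrCA !mulrA.
Qed.

Lemma poisson_pmf_sum (R : realType) (a : R) :
  0 < a -> (\sum_(k <oo) (poisson_pmf a k)%:E = 1)%E.
Proof.
move=> a0; rewrite nneseries_esumT => [|k]; last first.
  by rewrite lee_fin poisson_pmf_ge0.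
have /= := probability_setT (poisson_prob a 0).
by rewrite /poisson_prob a0.
Qed.

Lemma poisson_pmf_mean (R : realType) (a : R) :
  0 < a -> (\sum_(k <oo) (k%:R * poisson_pmf a k)%:E = a%:E)%E.
Proof.
move=> a0.
have f0 k : (0 <= (k%:R * poisson_pmf a k)%:E)%E.
  by rewrite lee_fin mulr_ge0 ?poisson_pmf_ge0.
rewrite nneseries_recl// mul0r add0e -nneseries_addn//.
under eq_eseriesr do rewrite addn1 (poisson_pmfS _ a0) EFinM.
rewrite nneseriesZl => [|k _]; last by rewrite lee_fin poisson_pmf_ge0.
by rewrite poisson_pmf_sum// mule1.
Qed.

(** * Natural-number-valued random variables *)

Lemma measurable_fun_nat_rv d d' (T : measurableType d)
    (U : sigmaRingType d') (R : realType) (P : probability T R)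
    (Z : {RV P >-> nat}) (D : set T) (f : nat -> U) :
  measurable D -> measurable_fun D (fun x => f (Z x)).
Proof.
move=> mD _ Y mY; apply: measurableI => //.
by rewrite -[X in measurable X]setTI; exact: (measurable_funPT Z _ (f @^-1` Y)).
Qed.

Lemma measurable_natr_rv d (T : measurableType d) (R : realType)
    (P : probability T R) (Z : {RV P >-> nat}) (D : set T) :
  measurable D -> measurable_fun D (fun x => (Z x)%:R : R).
Proof. by move=> mD; apply: measurable_fun_nat_rv. Qed.

Lemma measurable_eq_nat d (T : measurableType d) (R : realType)
    (P : probability T R) (Z : {RV P >-> nat}) (k : nat) :
  measurable [set x | Z x = k].
Proof.
by rewrite -[X in measurable X]setTI; exact: (measurable_funPT Z _ [set k]).
Qed.

(** With [f] the identity this evaluates a mean from joint probabilities, and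
    with [f = 1] it recovers [P D] by summing out [Z]. *)
Lemma integral_nat_rv d (T : measurableType d) (R : realType)
    (P : probability T R) (Z : {RV P >-> nat}) (D : set T)
    (f : nat -> \bar R) :
  measurable D -> (forall k, (0 <= f k)%E) ->
  (\int[P]_(x in D) f (Z x) =
   \sum_(k <oo) (f k * P (D `&` [set x | Z x = k])))%E.
Proof.
move=> mD f0.
have DE : D = \bigcup_k (D `&` [set x | Z x = k]).
  by apply/seteqP; split => [x Dx|x [k _ []//]]; exists (Z x).
have mF k : measurable (D `&` [set x | Z x = k]).
  by apply: measurableI => //; exact: measurable_eq_nat.
rewrite [in LHS]DE ge0_integral_bigcup//.
- apply: eq_eseriesr => k _; rewrite -integral_cst//.
  by apply: eq_integral => x /set_mem[_ /= ->].
- by apply: measurable_fun_nat_rv; exact: bigcup_measurable.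
- apply/trivIsetP => i j _ _ ij; apply/seteqP; split => x //= [[_ Zi] [_ Zj]].
  by move: ij; rewrite -Zi -Zj eqxx.
Qed.

(** * Poisson sums with a shared component *)

(** The joint law is the only form in which independence enters: the law of
    [(X, Y)] is obtained from it by summing over the values of [Z]. *)
Lemma cond_expectation_shared_component d (T : measurableType d)
    (R : realType) (P : probability T R) (X Y Z : {RV P >-> nat})
    (a b c : R) (m : nat) :
  0 < a -> 0 < b -> 0 < c ->
  (forall i j k, P [set x | [/\ X x = i, Y x = j & Z x = k]] =
    (poisson_pmf a i * poisson_pmf b j * poisson_pmf c k)%:E) ->
  cond_expectation P (fun x => (Z x + X x)%:R) [set x | (Y x + X x)%N = m] =
  (m%:R * a / (a + b) + c)%:E.
Proof.
move=> a0 b0 c0 jointXYZ.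
(* The subtraction is truncated when [i > m], but the cells stay disjoint since
   they differ in the value of [X]; only those with [i <= m] are summed. *)
pose B i := [set x | X x = i] `&` [set x | Y x = (m - i)%N].
pose p i := poisson_pmf a i * poisson_pmf b (m - i).
have mB i : measurable (B i) by apply: measurableI; exact: measurable_eq_nat.
have BZ i k :
    (P (B i `&` [set x | Z x = k]) = (p i)%:E * (poisson_pmf c k)%:E)%E.
  rewrite -EFinM -jointXYZ; congr (P _); apply/seteqP.
  by split => x /= [] => [[]|].
have PB i : P (B i) = (p i)%:E.
  rewrite -[LHS]mul1e -integral_cst// (integral_nat_rv Z (f := cst 1%E))//.
  under eq_eseriesr do rewrite mul1e BZ.
  rewrite nneseriesZl => [|k _]; last by rewrite lee_fin poisson_pmf_ge0.
  by rewrite poisson_pmf_sum// mule1.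
(* Independence on a cell: the integral of [Z] is [P (B i)] times its mean. *)
have intZB i : (\int[P]_(x in B i) (Z x)%:R%:E = (p i * c)%:E)%E.
  rewrite (integral_nat_rv Z (f := fun k => k%:R%:E))//.
  under eq_eseriesr do rewrite BZ muleCA -(EFinM _%:R).
  rewrite nneseriesZl => [|k _].
    by rewrite poisson_pmf_mean// EFinM.
  by rewrite lee_fin mulr_ge0 ?poisson_pmf_ge0.
have intB i :
    (\int[P]_(x in B i) (Z x + X x)%:R%:E = (p i * c + i%:R * p i)%:E)%E.
  transitivity (\int[P]_(x in B i) ((Z x)%:R%:E + cst i%:R%:E x))%E.
    by apply: eq_integral => x /set_mem[/= -> _]; rewrite natrD EFinD.
  rewrite ge0_integralD//.
  - by rewrite intZB integral_cst// [X in (_ + _ * X)%E]PB.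
  - by apply/measurable_EFinP; exact: measurable_natr_rv.
  - by move=> x _; rewrite lee_fin.
have tB : trivIset setT B.
  apply/trivIsetP => i j _ _ ij; apply/seteqP; split => x //=.
  by move=> [[Xi _] [Xj _]]; move: ij; rewrite -Xi -Xj eqxx.
have AE : [set x | (Y x + X x)%N = m] = \big[setU/set0]_(i < m.+1) B i.
  rewrite -bigcup_mkord; apply/seteqP; split => x /=.
    move=> YX; exists (X x); first by rewrite /= ltnS -YX leq_addl.
    by split=> //=; rewrite -YX addnK.
  by move=> [i /= im [/= -> ->]]; rewrite subnK.
have PA : P [set x | (Y x + X x)%N = m] = (poisson_pmf (a + b) m)%:E.
  rewrite AE measure_bigsetU//.
  transitivity (\sum_(i < m.+1) (p i)%:E)%E.
    by apply: eq_bigr => i _; exact: PB.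
  by rewrite sumEFin poisson_pmf_convolution.
have ab0 := addr_gt0 a0 b0.
rewrite /cond_expectation unlock PA.
have -> : (\int[P]_x
      (((fun x => (Z x + X x)%:R) \* \1_[set x | (Y x + X x)%N = m]) x)%:E =
    \int[P]_(x in [set x | (Y x + X x)%N = m]) (Z x + X x)%:R%:E)%E.
  rewrite [RHS]integral_mkcond; apply: eq_integral => x _.
  by rewrite epatch_indic /= EFinM.
rewrite AE -(big_mkord xpredT B) ge0_integral_bigsetU//.
- rewrite big_mkord; under eq_bigr do rewrite intB.
  rewrite sumEFin big_split -mulr_suml /= poisson_pmf_convolution//.
  rewrite poisson_pmf_convolution_mean//.
  have q0 := poisson_pmf_gt0 m ab0.
  rewrite inver gt_eqF// -EFinM; congr EFin.
  by field; rewrite !gt_eqF.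
- exact: iota_uniq.
- exact: sub_trivIset tB.
- apply/measurable_EFinP.
  under [X in measurable_fun _ X]eq_fun do rewrite natrD.
  apply: measurable_funD; apply: measurable_natr_rv;
    exact: bigsetU_measurable.
Qed.

Lemma poisson_joint_pmf (I : finType) d (T : measurableType d)
    (R : realType) (P : probability T R) (lambda : I -> R)
    (N : I -> R -> {RV P >-> nat}) (t : R) (k : I -> nat) :
  (forall i, poisson_process (lambda i) (N i)) ->
  mutually_independent P (fun i => sigma_process (fun t => N i t)) ->
  0 < t ->
  P [set x | forall i, N i t x = k i] =
  (\prod_i poisson_pmf (lambda i * t) (k i))%:E.
Proof.
move=> pois indep t0.
have -> : [set x | forall i, N i t x = k i] =
    \bigcap_(i in [set` [set: I]%SET]) [set x | N i t x = k i].
  by apply/seteqP; split => x /= Nk i; [move=> _ | apply: Nk; rewrite /= inE].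
rewrite indep => [|i _].
  rewrite -prodEFin; apply: eq_big => [i|i _]; first by rewrite inE.
  exact: poisson_process_law.
apply: sub_sigma_algebra; exists t; first exact: ltW.
by exists [set k i] => //; rewrite setTI.
Qed.

Theorem theorem2 (d : measure_display) (T : measurableType d) (R : realType)
    (P : probability T R) (lambda : 'I_3 -> R)
    (N : 'I_3 -> R -> {RV P >-> nat})
    (lambda_gt0 : forall i, 0 < lambda i)
    (N_poisson : forall i, poisson_process (lambda i) (N i))
    (N_independent :
      mutually_independent P (fun i => sigma_process (fun t => N i t)))
    (M : 'I_3 -> R -> T -> nat)
    (M1 : forall (t : R) x, 0 <= t -> M 1%R t x = (N 1%R t x + N 0%R t x)%N)
    (M2 : forall (t : R) x, 0 <= t -> M 2%R t x = (N 2%R t x + N 0%R t x)%N)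
    (r s : 'I_3) (rs : (r, s) = (1%R, 2%R) \/ (r, s) = (2%R, 1%R))
    (t : R) (t_gt0 : 0 < t) (m : nat) :
  cond_expectation P (fun x => (M s t x)%:R) [set x | M r t x = m] =
  (m%:R * lambda 0%R / (lambda r + lambda 0%R) + lambda s * t)%:E.
Proof.
have ME i x : i \in [:: r; s] -> M i t x = (N i t x + N 0%R t x)%N.
  have t0 := ltW t_gt0.
  by case: rs => -[-> ->]; rewrite !inE => /orP[]/eqP ->; rewrite ?M1 ?M2.
have -> : (fun x => (M s t x)%:R) =
    (fun x => (N s t x + N 0%R t x)%:R) :> (T -> R).
  by apply/funext => x; rewrite ME// !inE eqxx orbT.
have -> : [set x | M r t x = m] = [set x | (N r t x + N 0%R t x)%N = m].
  by apply/seteqP; split => x /=; rewrite ME ?inE ?eqxx.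
have lt_gt0 i : 0 < lambda i * t by rewrite mulr_gt0.
rewrite (@cond_expectation_shared_component _ _ _ _ _ _ _ (lambda 0 * t)
  (lambda r * t) (lambda s * t))//.
  congr (_%:E); congr (_ + _).
  have t_neq0 : t != 0 by rewrite gt_eqF.
  have l_neq0 : lambda r + lambda 0 != 0 by rewrite gt_eqF// addr_gt0.
  rewrite -mulrDl [lambda 0 + _]addrC.
  by field; rewrite t_neq0 l_neq0.
move=> i j k.
have perm3 : perm_eq (index_enum 'I_3) [:: 0; r; s].
  apply: uniq_perm; first exact: index_enum_uniq.
    by case: rs => -[-> ->].
  move=> l; rewrite mem_index_enum !inE.
  by case: rs => -[-> ->]; case: l => -[|[|[|]]].
have /perm_uniq := perm3; rewrite index_enum_uniq /= !inE negb_or !andbT.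
move/esym/andP => [/andP[r0 s0] rs_neq].
(* As [0], [r], [s] are distinct, values can be prescribed on them
   independently; this treats both cases of [(r, s)] at once. *)
pose n (l : 'I_3) := if l == 0 then i else if l == r then j else k.
have n0 : n 0 = i by rewrite /n eqxx.
have nr : n r = j by rewrite /n eq_sym (negPf r0) eqxx.
have ns : n s = k by rewrite /n eq_sym (negPf s0) eq_sym (negPf rs_neq).
have := poisson_joint_pmf n N_poisson N_independent t_gt0.
rewrite (perm_big _ perm3) !big_cons big_nil /= mulr1 mulrA n0 nr ns => <-.
congr (P _); apply/seteqP; split => [x /= [N0 Nr Ns] l|x /= Nn]; last first.
  by split; rewrite Nn.
have : l \in [:: 0; r; s] by rewrite -(perm_mem perm3) mem_index_enum.
by rewrite !inE => /or3P[] /eqP ->; rewrite ?n0 ?nr ?ns.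
Qed.
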